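(* Let $F$ be a field. Applying the Kolesnikov–Pozhidaev (KP) algorithm to the defining identities (L1), (L2), (L3) of Lie triple systems produces the variety of ternary algebras with one trilinear operation $\langle -,-,-\rangle$ satisfying the identities $$\langle a,\langle b,c,d\rangle,e\rangle+\langle a,\langle c,b,d\rangle,e\rangle\equiv 0,\tag{LTS1}$$ $$\langle a,\langle b,c,d\rangle,e\rangle+\langle a,\langle c,d,b\rangle,e\rangle+\langle a,\langle d,b,c\rangle,e\rangle\equiv 0,\tag{LTS2}$$ $$\langle a,b,\langle c,d,e\rangle\rangle-\langle\langle a,b,c\rangle,d,e\rangle+\langle\langle a,b,d\rangle,c,e\rangle-\langle\langle a,b,e\rangle,d,c\rangle+\langle\langle a,b,e\rangle,c,d\rangle\equiv 0,\tag{LTS-B}$$ $$\langle\langle c,d,e\rangle,b,a\rangle-\langle\langle c,d,e\rangle,a,b\rangle-\langle\langle c,b,a\rangle,d,e\rangle+\langle\langle c,a,b\rangle,d,e\rangle-\langle c,\langle a,b,d\rangle,e\rangle-\langle c,d,\langle a,b,e\rangle\rangle\equiv 0.\tag{LTS3}$$ Explicitly, this means: let $T$ be a vector space over $F$ with three trilinear operations $[-,-,-]_1,[-,-,-]_2,[-,-,-]_3$. Then these operations satisfy all the identities in the output of the KP algorithm applied to (L1), (L2), (L3) if and only if, for all $a,b,c\in T$, $$[a,b,c]_2=-[b,a,c]_1,\qquad [a,b,c]_3=[c,b,a]_1-[c,a,b]_1,$$ and the operation $\langle a,b,c\rangle=[a,b,c]_1$ satisfies (LTS1), (LTS2), (LTS-B)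 and (LTS3).
   Context: The symbol $\equiv$ in an identity means that the equation holds for all values of the arguments. A Lie triple system is a vector space with a trilinear operation $[a,b,c]$ satisfying (L1) $[a,b,c]+[b,a,c]\equiv 0$; (L2) $[a,b,c]+[b,c,a]+[c,a,b]\equiv 0$; (L3) $[a,b,[c,d,e]]-[[a,b,c],d,e]-[c,[a,b,d],e]-[c,d,[a,b,e]]\equiv 0$. KP algorithm (for a trilinear operation $[-,-,-]$). Introduce three new trilinear operations $[-,-,-]_1,[-,-,-]_2,[-,-,-]_3$. Part 1. For each multilinear identity of degree $d$ in the original operation and each indeterminate $x$ occurring in it (the ''central'' indeterminate), form a new identity by converting each monomial as follows: each occurrence of the operation $[\dots]$ in the monomial is replaced by $[\dots]_j$ if $x$ occurs within its $j$-th argument; if $x$ occurs in none of its arguments, it is replaced by $[\dots]_1$ when $x$ lies to the left of this occurrence, and by $[\dots]_3$ when $x$ lies to the right of this occurrence. Thus each identity of degree $d$ gives $d$ new identities. Part 2. For all $i\ne j$ in $\{1,2,3\}$ and all $k,\ell\in\{1,2,3\}$, include the identity saying that in the $i$-th argument of $[\dots]_j$ one may replace $[b_1,b_2,b_3]_k$ by $[b_1,b_2,b_3]_\ell$. Applied to (L1), (L2), (L3), the output of Part 1 is the following eleven identities: $[a,b,c]_1+[b,a,c]_2\equiv0$; $[a,b,c]_2+[b,a,c]_1\equiv0$; $[a,b,c]_3+[b,a,c]_3\equiv0$; $[a,b,c]_1+[b,c,a]_3+[c,a,b]_2\equiv0$; $[a,b,c]_2+[b,c,a]_1+[c,a,b]_3\equiv0$;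 $[a,b,c]_3+[b,c,a]_2+[c,a,b]_1\equiv0$; $[a,b,[c,d,e]_1]_1-[[a,b,c]_1,d,e]_1-[c,[a,b,d]_1,e]_2-[c,d,[a,b,e]_1]_3\equiv0$; $[a,b,[c,d,e]_1]_2-[[a,b,c]_2,d,e]_1-[c,[a,b,d]_2,e]_2-[c,d,[a,b,e]_2]_3\equiv0$; $[a,b,[c,d,e]_1]_3-[[a,b,c]_3,d,e]_1-[c,[a,b,d]_1,e]_1-[c,d,[a,b,e]_1]_1\equiv0$; $[a,b,[c,d,e]_2]_3-[[a,b,c]_3,d,e]_2-[c,[a,b,d]_3,e]_2-[c,d,[a,b,e]_1]_2\equiv0$; $[a,b,[c,d,e]_3]_3-[[a,b,c]_3,d,e]_3-[c,[a,b,d]_3,e]_3-[c,d,[a,b,e]_3]_3\equiv0$. The output of Part 2 is, for $k\in\{2,3\}$: $[a,[b,c,d]_1,e]_1\equiv[a,[b,c,d]_k,e]_1$; $[a,b,[c,d,e]_1]_1\equiv[a,b,[c,d,e]_k]_1$; $[[a,b,c]_1,d,e]_2\equiv[[a,b,c]_k,d,e]_2$; $[a,b,[c,d,e]_1]_2\equiv[a,b,[c,d,e]_k]_2$; $[[a,b,c]_1,d,e]_3\equiv[[a,b,c]_k,d,e]_3$; $[a,[b,c,d]_1,e]_3\equiv[a,[b,c,d]_k,e]_3$. *)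

(* Defs.v *)
From HB Require Import structures.
From mathcomp Require Import all_boot all_order all_algebra.
Set Implicit Arguments.
Unset Strict Implicit.
Unset Printing Implicit Defensive.
Import GRing.Theory.
Local Open Scope ring_scope.

Definition trilinear (F : fieldType) (T : lmodType F)
    (br : T -> T -> T -> T) : Prop :=
  [/\ forall b c, linear (fun a => br a b c),
      forall a c, linear (fun b => br a b c)
    & forall a b, linear (fun c => br a b c)].

(* Nonassociative monomials in indeterminates numbered by nat and ternary
   operation symbols taken from O. *)
Inductive monomial (O : Type) : Type :=
  | Var of nat
  | Op of O & monomial O & monomial O & monomial O.
Arguments Var {O} _.

Fixpoint indets (O : Type) (m : monomial O) : seq nat :=
  match m with
  | Var n => [:: n]
  | Op _ m1 m2 m3 => indets m1 ++ indets m2 ++ indets m3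
  end.

Fixpoint eval (O T : Type) (op : O -> T -> T -> T -> T) (v : nat -> T)
    (m : monomial O) : T :=
  match m with
  | Var n => v n
  | Op o m1 m2 m3 => op o (eval op v m1) (eval op v m2) (eval op v m3)
  end.

(* A list of (coefficient, monomial) pairs; f stands for the identity f = 0. *)
Definition ternary_poly (F : fieldType) (O : Type) : Type :=
  seq (F * monomial O).

Definition satisfies (F : fieldType) (O : Type) (T : lmodType F)
    (op : O -> T -> T -> T -> T) (f : ternary_poly F O) : Prop :=
  forall v : nat -> T, \sum_(t <- f) t.1 *: eval op v t.2 = 0.

(* Argument positions of a ternary operation; they also index the three new
   operations. *)
Inductive argpos : Type := P1 | P2 | P3.

Fixpoint relabel (O O' : Type) (o : O') (m : monomial O) : monomial O' :=
  match m with
  | Var n => Var n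
  | Op _ m1 m2 m3 => Op o (relabel o m1) (relabel o m2) (relabel o m3)
  end.

(* When x lies in one argument of an operation symbol, all the symbols in the
   arguments to the left of that one have x on their right and are indexed by
   P3, and all those in the arguments to the right of it are indexed by P1.
   The last branch is reached only if x does not occur in m, which never
   happens for the monomials of a multilinear identity involving x. *)
Fixpoint kp_monomial (x : nat) (m : monomial unit) : monomial argpos :=
  match m with
  | Var n => Var n
  | Op _ m1 m2 m3 =>
      if x \in indets m1 then
        Op P1 (kp_monomial x m1) (relabel P1 m2) (relabel P1 m3)
      else if x \in indets m2 then
        Op P2 (relabel P3 m1) (kp_monomial x m2) (relabel P1 m3)
      else if x \in indets m3 then
        Op P3 (relabel P3 m1) (relabel P3 m2) (kp_monomial x m3)
      else relabel P1 m
  end.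

Definition kp_central (F : fieldType) (x : nat) (f : ternary_poly F unit) :
    ternary_poly F argpos :=
  [seq (t.1, kp_monomial x t.2) | t <- f].

(* m in the i-th argument of the j-th operation, the other two arguments being
   the indeterminates 3 and 4, which are assumed not to occur in m. *)
Definition plug (i j : argpos) (m : monomial argpos) : monomial argpos :=
  match i with
  | P1 => Op j m (Var 3) (Var 4)
  | P2 => Op j (Var 3) m (Var 4)
  | P3 => Op j (Var 3) (Var 4) m
  end.

Definition kp_replace (F : fieldType) (i j k l : argpos) : ternary_poly F argpos :=
  [:: (1, plug i j (Op k (Var 0) (Var 1) (Var 2)));
      (- 1, plug i j (Op l (Var 0) (Var 1) (Var 2)))].

(* The set of identities produced by the Kolesnikov-Pozhidaev algorithm from a
   set of multilinear identities. *)
Inductive kp_output (F : fieldType) (ids : ternary_poly F unit -> Prop) :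
    ternary_poly F argpos -> Prop :=
  | KP_part1 f x : ids f -> has (fun t => x \in indets t.2) f ->
      kp_output ids (kp_central x f)
  | KP_part2 i j k l : i <> j -> kp_output ids (kp_replace F i j k l).

Definition L1 (F : fieldType) : ternary_poly F unit :=
  let a := Var 0 in let b := Var 1 in let c := Var 2 in
  [:: (1, Op tt a b c); (1, Op tt b a c)].

Definition L2 (F : fieldType) : ternary_poly F unit :=
  let a := Var 0 in let b := Var 1 in let c := Var 2 in
  [:: (1, Op tt a b c); (1, Op tt b c a); (1, Op tt c a b)].

Definition L3 (F : fieldType) : ternary_poly F unit :=
  let a := Var 0 in let b := Var 1 in let c := Var 2 in
  let d := Var 3 in let e := Var 4 in
  [:: (1, Op tt a b (Op tt c d e));
      (- 1, Op tt (Op tt a b c) d e);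
      (- 1, Op tt c (Op tt a b d) e);
      (- 1, Op tt c d (Op tt a b e))].

Definition lie_triple_identities (F : fieldType) (f : ternary_poly F unit) :
    Prop :=
  [\/ f = L1 F, f = L2 F | f = L3 F].

Definition LTS1 (T : zmodType) (br : T -> T -> T -> T) : Prop :=
  forall a b c d e, br a (br b c d) e + br a (br c b d) e = 0.

Definition LTS2 (T : zmodType) (br : T -> T -> T -> T) : Prop :=
  forall a b c d e,
    br a (br b c d) e + br a (br c d b) e + br a (br d b c) e = 0.

Definition LTSB (T : zmodType) (br : T -> T -> T -> T) : Prop :=
  forall a b c d e,
    br a b (br c d e) - br (br a b c) d e + br (br a b d) c e
      - br (br a b e) d c + br (br a b e) c d = 0.

Definition LTS3 (T : zmodType) (br : T -> T -> T -> T) : Prop :=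
  forall a b c d e,
    br (br c d e) b a - br (br c d e) a b - br (br c b a) d e
      + br (br c a b) d e - br c (br a b d) e - br c d (br a b e) = 0.

(* Main.v *)
(* Two of the identities coming from (L1) and (L2) express the second and the
   third operation through the first one. After this substitution, the
   replacement identities say that the inner product in the second or third
   argument of <-,-,-> obeys (L1) and (L2): for the second argument this is
   (LTS1) and (LTS2), and for the third one it follows from (LTS-B), whose other
   terms satisfy (L1) and (L2) in c, d, e. Modulo these, the five identities
   coming from (L3) are (LTS-B), (LTS-B) with a and b exchanged, (LTS3), (LTS3)
   with c and d exchanged, and a difference of two instances of (LTS3). *)
Require Import Defs.
From HB Require Import structures.
From mathcomp Require Import all_boot all_order all_algebra.
Import GRing.Theory.
Local Open Scope ring_scope.

Lemma linear_sub {F : fieldType} {U V : lmodType F} {f : U -> V} (f_lin : linear f) x y :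
  f (x - y) = f x - f y.
Proof. by rewrite addrC -scaleN1r f_lin scaleN1r addrC. Qed.

Lemma sub_opp {U V : zmodType} {f : U -> V} (f_sub : forall x y, f (x - y) = f x - f y) x :
  f (- x) = - f x.
Proof. by rewrite -[- x]sub0r -{1}(subrr 0) !f_sub subrr sub0r. Qed.

Lemma addr_cancel {V : zmodType} {x s s' : V} : s = - x + s' -> s' = 0 -> x + s = 0.
Proof. by move=> -> ->; rewrite addr0 subrr. Qed.

Lemma addr_cancelN {V : zmodType} {x s s' : V} : s = x + s' -> s' = 0 -> - x + s = 0.
Proof. by move=> -> ->; rewrite addr0 addNr. Qed.

(** Derives a goal from a known identity when both have the same difference of sides, which [zmod]
    can check. *)
Lemma eq_of_linear_comb {V : zmodType} {x y z w : V} : z = w -> x - y - (z - w) = 0 -> x = y.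
Proof. by move=> ->; rewrite subrr subr0 => /subr0_eq. Qed.

Lemma addr_pull {V : zmodType} (a : V) {s t s' : V} : s = t + s' -> a + s = t + (a + s').
Proof. by move=> ->; rewrite addrCA. Qed.

(** Returns a proof of [s = t + r] for a right-nested sum [s]; the second branch is for [t] as last
    summand. *)
Ltac pull t s :=
  match s with
  | ?a + ?r =>
    let _ := match goal with _ => unify a t end in constr:(erefl s : s = t + r)
  | ?a + ?b =>
    let _ := match goal with _ => unify b t end in constr:(addrC a b : s = t + a)
  | ?a + ?r => let H := pull t r in constr:(addr_pull a H)
  end.

(* Decides identities [s = 0] of abelian groups by cancelling each term of s
   against its opposite. *)
Ltac zmod :=
  rewrite ?(opprD, opprK, oppr0, addr0, add0r, sub0r, subr0);
  rewrite -?addrA;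
  repeat lazymatch goal with
  | |- - ?x + ?x = 0 => exact: addNr
  | |- ?x + - ?x = 0 => exact: subrr
  | |- - ?x + ?s = 0 => let H := pull x s in apply: (addr_cancelN H)
  | |- ?x + ?s = 0 => let H := pull (- x) s in apply: (addr_cancel H)
  end.

Section KP.

Context {F : fieldType} {T : lmodType F} {op : argpos -> T -> T -> T -> T}.
Hypothesis op_trilinear : forall j, trilinear (op j).

Lemma op_sub1 j b c x y : op j (x - y) b c = op j x b c - op j y b c.
Proof. by case: (op_trilinear j) => H _ _; rewrite (linear_sub (H b c)). Qed.

Lemma op_sub2 j a c x y : op j a (x - y) c = op j a x c - op j a y c.
Proof. by case: (op_trilinear j) => _ H _; rewrite (linear_sub (H a c)). Qed.

Lemma op_sub3 j a b x y : op j a b (x - y) = op j a b x - op j a b y.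
Proof. by case: (op_trilinear j) => _ _ H; rewrite (linear_sub (H a b)). Qed.

Definition op_opp1 j b c := sub_opp (op_sub1 j b c).
Definition op_opp2 j a c := sub_opp (op_sub2 j a c).
Definition op_opp3 j a b := sub_opp (op_sub3 j a b).
Definition op_additive := (op_sub1, op_sub2, op_sub3, op_opp1, op_opp2, op_opp3).

Local Notation valuation a b c d e := (nth (0 : T) [:: a; b; c; d; e]).

Section Forward.

Hypothesis kp : forall f : ternary_poly F argpos,
  kp_output (@lie_triple_identities F) f -> satisfies op f.

Lemma kp_part2 i j k l (v : nat -> T) : i <> j ->
  eval op v (plug i j (Op k (Var 0) (Var 1) (Var 2))) =
  eval op v (plug i j (Op l (Var 0) (Var 1) (Var 2))).
Proof.
move=> /(@KP_part2 F (@lie_triple_identities F) _ _ k l) /kp /(_ v).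
by rewrite /satisfies !big_cons big_nil /= scale1r scaleN1r addr0 => /subr0_eq.
Qed.

Lemma kp_L1 x : (x < 3)%N -> satisfies op (kp_central x (L1 F)).
Proof. by move=> x_lt; apply/kp/KP_part1; [exact: Or31 | case: x x_lt => [|[|[|]]]]. Qed.

Lemma kp_L2 x : (x < 3)%N -> satisfies op (kp_central x (L2 F)).
Proof. by move=> x_lt; apply/kp/KP_part1; [exact: Or32 | case: x x_lt => [|[|[|]]]]. Qed.

Lemma kp_L3 x : (x < 5)%N -> satisfies op (kp_central x (L3 F)).
Proof. by move=> x_lt; apply/kp/KP_part1; [exact: Or33 | case: x x_lt => [|[|[|[|[|]]]]]]. Qed.

Lemma kp_op2 a b c : op P2 a b c = - op P1 b a c.
Proof.
have := @kp_L1 1 isT (valuation a b c 0 0).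
rewrite !big_cons big_nil /= !scale1r addr0 => eq0.
by apply: (eq_of_linear_comb eq0); zmod.
Qed.

Lemma kp_op3 a b c : op P3 a b c = op P1 c b a - op P1 c a b.
Proof.
(* The cyclic shift of the values makes the term under [P3] equal to [op P3 a b c]. *)
have := @kp_L2 0 isT (valuation c a b 0 0).
rewrite !big_cons big_nil /= !scale1r addr0 !kp_op2 => eq0.
by apply: (eq_of_linear_comb eq0); zmod.
Qed.

Lemma kp_inner2 k a b c d e : op P1 a (op k b c d) e = op P1 a (op P1 b c d) e.
Proof. exact: (@kp_part2 P2 P1 k P1 (valuation b c d a e)). Qed.

Lemma kp_inner3 k a b c d e : op P1 a b (op k c d e) = op P1 a b (op P1 c d e).
Proof. exact: (@kp_part2 P3 P1 k P1 (valuation c d e a b)). Qed.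

Lemma kp_LTS1 : LTS1 (op P1).
Proof. by move=> a b c d e; rewrite -(kp_inner2 P2) kp_op2 op_opp2 addNr. Qed.

Lemma kp_LTS2 : LTS2 (op P1).
Proof.
(* The first summand, passed through [P3], cancels the third; what it leaves cancels the second,
   passed through [P2]. *)
move=> a b c d e; rewrite -(kp_inner2 P3) kp_op3 op_sub2 -(kp_inner2 P2 _ c).
by rewrite kp_op2 op_opp2; zmod.
Qed.

(** This is (L3) with central indeterminate [a], after elimination of [P2] and [P3]. *)
Lemma kp_LTSB : LTSB (op P1).
Proof.
move=> a b c d e; have := @kp_L3 0 isT (valuation a b c d e).
rewrite !big_cons big_nil /= !(scale1r, scaleN1r) addr0 !kp_op2 !kp_op3 => eq0.
by apply: (eq_of_linear_comb eq0); zmod.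
Qed.

(** Here the central indeterminate of (L3) is [c]. *)
Lemma kp_LTS3 : LTS3 (op P1).
Proof.
move=> a b c d e; have := @kp_L3 2 isT (valuation a b c d e).
rewrite !big_cons big_nil /= !(scale1r, scaleN1r) addr0 !kp_op3 !op_additive => eq0.
by apply: (eq_of_linear_comb eq0); zmod.
Qed.

End Forward.

Section Backward.

Hypothesis op2E : forall a b c, op P2 a b c = - op P1 b a c.
Hypothesis op3E : forall a b c, op P3 a b c = op P1 c b a - op P1 c a b.
Hypothesis lts1 : LTS1 (op P1).
Hypothesis lts2 : LTS2 (op P1).
Hypothesis ltsB : LTSB (op P1).
Hypothesis lts3 : LTS3 (op P1).

Lemma op1_inner2 k a b c d e : op P1 a (op k b c d) e = op P1 a (op P1 b c d) e.
Proof.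
case: k => //.
  by rewrite op2E op_opp2; apply: (eq_of_linear_comb (esym (lts1 a c b d e))); zmod.
rewrite op3E op_sub2.
(* (LTS1) at [c, d, b] minus (LTS2) at [b, c, d]. *)
by apply: (eq_of_linear_comb (etrans (lts1 a c d b e) (esym (lts2 a b c d e)))); zmod.
Qed.

(** As a rewriting rule, (LTS-B) moves all nesting from the third argument to the first. *)
Lemma op1_inner3E a b c d e : op P1 a b (op P1 c d e) =
  op P1 (op P1 a b c) d e - op P1 (op P1 a b d) c e
  + op P1 (op P1 a b e) d c - op P1 (op P1 a b e) c d.
Proof. by apply: (eq_of_linear_comb (ltsB a b c d e)); zmod. Qed.

Lemma op1_inner3 k a b c d e : op P1 a b (op k c d e) = op P1 a b (op P1 c d e).
Proof.
apply: subr0_eq; case: k; first exact: subrr.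
  by rewrite op2E op_opp3 !op1_inner3E; zmod.
by rewrite op3E op_sub3 !op1_inner3E; zmod.
Qed.

(** Written through [P1], the [j]-th operation has its [j]-th argument in first place, so for
    [i <> j] the inner product lands in the second or third argument of [op P1]. *)
Lemma kp_replace_satisfied i j k l : i <> j -> satisfies op (kp_replace F i j k l).
Proof.
move=> ij v; rewrite !big_cons big_nil /= scale1r scaleN1r addr0.
apply/eqP; rewrite subr_eq0; apply/eqP.
by case: i j ij => [] [] //= _; rewrite ?op2E ?op3E ?(op1_inner2 k) ?(op1_inner2 l)
  ?(op1_inner3 k) ?(op1_inner3 l).
Qed.

Lemma kp_central_L1_satisfied x :
  has (fun t => x \in indets t.2) (L1 F) -> satisfies op (kp_central x (L1 F)).
Proof.
case: x => [|[|[|]]] //= _ v; rewrite !big_cons big_nil /= !scale1r addr0 ?op2E ?op3E; zmod.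
Qed.

Lemma kp_central_L2_satisfied x :
  has (fun t => x \in indets t.2) (L2 F) -> satisfies op (kp_central x (L2 F)).
Proof.
case: x => [|[|[|]]] //= _ v; rewrite !big_cons big_nil /= !scale1r addr0 ?op2E ?op3E; zmod.
Qed.

Lemma kp_central_L3_satisfied x :
  has (fun t => x \in indets t.2) (L3 F) -> satisfies op (kp_central x (L3 F)).
Proof.
case: x => [|[|[|[|[|]]]]] //= _ v;
  rewrite !big_cons big_nil /= !(scale1r, scaleN1r) addr0;
  move: (v 0%N) (v 1%N) (v 2%N) (v 3%N) (v 4%N) => a b c d e.
- rewrite !op2E !op3E.
  by apply: (eq_of_linear_comb (ltsB a b c d e)); zmod.
- rewrite !op2E !op3E !op_additive.
  by apply: (eq_of_linear_comb (esym (ltsB b a c d e))); zmod.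
- rewrite !op3E !op_additive.
  by apply: (eq_of_linear_comb (lts3 a b c d e)); zmod.
(* The inner [op P3 a b c] is replaced by [op P1 a b c] before [op3E] can expand it, to match the
   term of (LTS3). *)
- rewrite [op P2 (op P3 a b c) d e]op2E (op1_inner2 P3) !op2E !op3E !op_additive.
  by apply: (eq_of_linear_comb (esym (lts3 a b d c e))); zmod.
(* Only the outer operations are expanded first; inner ones in second or third arguments then become
   [P1], and those in first arguments are expanded last. *)
- rewrite (op3E a b (op P3 c d e)) (op3E (op P3 a b c)) (op3E c (op P3 a b d)).
  rewrite (op3E c d (op P3 a b e)) !(op1_inner2 P3) !(op1_inner3 P3) !op3E !op_additive.
  (* The central [e] takes the place of [c] in (LTS3); the two instances differ by exchanging [c]
     and [d]. *)
  have eqL := lts3 a b e d c.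
  by apply: (eq_of_linear_comb (etrans eqL (esym (lts3 a b e c d)))); zmod.
Qed.

End Backward.
End KP.

Theorem theorem7 (F : fieldType) (T : lmodType F)
    (op : argpos -> T -> T -> T -> T) (op_trilinear : forall j, trilinear (op j)) :
  (forall f : ternary_poly F argpos,
     kp_output (@lie_triple_identities F) f -> satisfies op f)
  <->
  [/\ forall a b c, op P2 a b c = - op P1 b a c,
      forall a b c, op P3 a b c = op P1 c b a - op P1 c a b
    & [/\ LTS1 (op P1), LTS2 (op P1), LTSB (op P1) & LTS3 (op P1)]].
Proof.
split=> [kp | [op2E op3E [lts1 lts2 ltsB lts3]] _ [f x [] -> hx | i j k l ij]].
- split; [exact: kp_op2 | exact: kp_op3 | split].
  + exact: kp_LTS1.
  + exact: kp_LTS2.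
  + exact: kp_LTSB.
  + exact: kp_LTS3.
- exact: kp_central_L1_satisfied.
- exact: kp_central_L2_satisfied.
- exact: kp_central_L3_satisfied.
- exact: kp_replace_satisfied.
Qed.
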